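(* Let $\mu$ be the uniform probability measure on the unit circle $\{z\in\mathbb{C} : |z|=1\}$, let $X_1, X_2, \ldots$ be IID with law $\mu$, and let $f_n(z) := \prod_{j=1}^n (z-X_j)$. Then $\mathcal{Z}(f_n')$ converges to the unit circle in probability as $n\to\infty$; that is, for every $\epsilon > 0$, the random variable $\mathcal{Z}(f_n')\big(\{z \in \mathbb{C} : \big||z|-1\big| > \epsilon\}\big)$ converges to $0$ in probability as $n\to\infty$.
   Context: For a non-constant polynomial $f$ of degree $d$, $\mathcal{Z}(f)$ denotes the empirical distribution of its roots, $\mathcal{Z}(f) = \frac{1}{d}\sum_{i=1}^d \delta_{r_i}$, where $r_1,\ldots,r_d$ are the roots of $f$ listed with multiplicity. Here $\mathcal{Z}(f_n')$ is considered for $n\ge 2$. *)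

(* Defs.v *)
From HB Require Import structures.
From mathcomp Require Import all_boot all_order all_algebra.
From mathcomp Require Import complex.
From mathcomp Require Import all_classical all_reals all_analysis.
From mathcomp Require Import measurable_realfun lra.

Set Implicit Arguments.
Unset Strict Implicit.
Unset Printing Implicit Defensive.

Import Order.TTheory GRing.Theory Num.Theory.
Import numFieldNormedType.Exports.

Local Open Scope classical_set_scope.
Local Open Scope complex_scope.
Local Open Scope ring_scope.

(* The complex plane with its Borel sigma-algebra. The topology of R[i] is
   only available on its alias R[i]^o. *)
Definition borelC (R : realType) := g_sigma_algebraType (@open R[i]^o).

Section uniform_circle.
Variable R : realType.

(* t |-> exp(2 i pi t) *)
Definition circle_map (t : measurableTypeR R) : borelC R :=
  cos (2 * pi * t) +i* sin (2 * pi * t).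

Lemma continuous_circle_map : continuous (circle_map : R -> R[i]^o).
Proof.
move=> t; apply/cvgrPdist_lt => e e0.
have /complex_realP[e1 ee] := gtr0_real e0.
rewrite ee ltcR in e0 *.
have ct : {for t, continuous (fun x : R => cos (2 * pi * x))}.
  apply: continuous_comp; last exact: continuous_cos.
  exact: mulrl_continuous.
have st : {for t, continuous (fun x : R => sin (2 * pi * x))}.
  apply: continuous_comp; last exact: continuous_sin.
  exact: mulrl_continuous.
have e2 : 0 < e1 / 2 by rewrite divr_gt0.
move/cvgrPdist_lt : ct => /(_ _ e2) ct.
move/cvgrPdist_lt : st => /(_ _ e2) st.
near=> x.
have c : `|cos (2 * pi * t) - cos (2 * pi * x)| < e1 / 2 by near: x.
have s : `|sin (2 * pi * t) - sin (2 * pi * x)| < e1 / 2 by near: x.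
rewrite /circle_map normc_def ltcR /=.
set a := cos _ - _ in c *; set b := sin _ - _ in s *.
have -> : e1 = Num.sqrt (e1 ^+ 2) by rewrite sqrtr_sqr gtr0_norm.
rewrite ltr_sqrt ?exprn_gt0//.
have a2 : a ^+ 2 < (e1 / 2) ^+ 2.
  by rewrite -(real_normK (num_real a)) ltrXn2r// ltW.
have b2 : b ^+ 2 < (e1 / 2) ^+ 2.
  by rewrite -(real_normK (num_real b)) ltrXn2r// ltW.
by have := sqr_ge0 e1; nra.
Unshelve. all: by end_near. Qed.

Lemma measurable_circle_map : measurable_fun [set: measurableTypeR R] circle_map.
Proof.
apply: (@measurability _ _ (measurableTypeR R) (borelC R) setT
  circle_map (@open R[i]^o) erefl).
move=> _ [B oB <-]; rewrite setTI.
apply: open_measurable.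
by move/continuousP : continuous_circle_map; exact.
Qed.

HB.instance Definition _ :=
  isMeasurableFun.Build _ _ (measurableTypeR R) (borelC R)
    circle_map measurable_circle_map.

(* Law of exp(2 i pi U) for U uniform on [0, 1]. *)
Definition uniform_circle : probability (borelC R) R :=
  distribution (uniform_prob (@ltr01 R)) circle_map.

End uniform_circle.

Section root_distribution.
Variable R : realType.

(* The roots of p listed with multiplicity, in an arbitrary order. *)
Definition poly_roots (p : {poly R[i]}) : seq R[i] :=
  sval (closed_field_poly_normal p).

(* Empirical root distribution, a probability measure for deg p >= 1; for a
   constant p this is the zero measure. *)
Definition root_dist (p : {poly R[i]}) : {measure set (borelC R) -> \bar R} :=
  let d := (size p).-1 in
  mscale ((d%:R : R)^-1)%:nng
    (msum (fun k => \d_((poly_roots p)`_k : borelC R)) d).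

End root_distribution.

Section random_variables.
Context d (T : measurableType d) (R : realType) (P : probability T R).

Definition mutually_independent (I : choiceType) d' (U : measurableType d')
    (X : I -> {RV P >-> U}) :=
  forall (J : seq I) (B : I -> set U), uniq J ->
    (forall j, measurable (B j)) ->
    P (\bigcap_(j in [set` J]) (X j @^-1` B j)) =
    (\prod_(j <- J) P (X j @^-1` B j))%E.

(* Measurability is part of the notion, since P is only meaningful on
   measurable events. *)
Definition cvg_in_probability (Y : nat -> T -> R) (Z : T -> R) :=
  [/\ forall n, measurable_fun [set: T] (Y n),
      measurable_fun [set: T] Z &
      forall e : R, 0 < e ->
        P [set w | e < `|Y n w - Z w|] @[n --> \oo] --> 0%E].

End random_variables.

(* Main.v *)
Require Import Defs.
From mathcomp Require Import all_boot all_order all_algebra.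
From mathcomp Require Import complex.
From mathcomp Require Import all_classical all_reals all_analysis.
From mathcomp Require Import measurable_realfun ring lra.

(** Let [y_1, ..., y_(n-1)] be the critical points of [f_n].  Almost surely
    all [X_j] are on the unit circle, so the [y_k] are in the closed unit disc
    by Gauss-Lucas ([deriv_rootprod_neq0]); a critical point at distance more
    than [eps] from the circle then has modulus at most some fixed [q < 1].
    The constant coefficient of [f_n'] can be computed in two ways.  As a
    product over its roots, its modulus is [n * prod_k |y_k|], hence at most
    [n * q ^ N] where [N] counts the critical points off the circle.  As a sum
    over the roots of [f_n], its modulus is [|sum_j 1 / X_j| = |sum_j X_j|].
    Therefore ([norm_sum_le_critical])

      [|sum_j X_j| <= n * q ^ N].

    If a proportion at least [e] of the critical points were off the circle,
    the right-hand side would be exponentially small ([exp_decay]), and it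
    suffices that [sum_j X_j] is bounded away from 0 with high probability.
    The real part of [X_j] has no atoms, and its law gives uniformly small
    mass to short intervals ([cos_small_ball]); adding independent variables
    cannot increase this concentration, whatever the number of terms
    ([anti_concentration]).

    Convergence in probability also asks that the proportion of critical
    points off the circle be measurable, although the roots are listed in an
    arbitrary order that may depend on [w] in a non-measurable way.  The
    number of roots in an open set is lower semicontinuous in the
    coefficients ([count_roots_lsc]), and so a countable union of rational
    boxes in coefficient space describes the event that at least [m] roots
    lie in the set ([measurable_count_roots]). *)

Set Implicit Arguments.
Unset Strict Implicit.
Unset Printing Implicit Defensive.

Import Order.TTheory GRing.Theory Num.Theory.
Import numFieldNormedType.Exports.

Local Open Scope classical_set_scope.
Local Open Scope complex_scope.
Local Open Scope ring_scope.

(** * Continuity of roots *)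

Section root_continuity.
Variable C : numFieldType.
Implicit Types (p : {poly C}) (ys zs : seq C).

Definition rootprod ys : {poly C} := \prod_(y <- ys) ('X - y%:P).

Lemma size_rootprod ys : size (rootprod ys) = (size ys).+1.
Proof. exact: size_prod_XsubC. Qed.

Lemma rootprod_cons y ys : rootprod (y :: ys) = ('X - y%:P) * rootprod ys.
Proof. by rewrite /rootprod big_cons. Qed.

(** Stands in for a minimum: the order of a general [numFieldType] is partial,
    and all positive elements have such an explicit common lower bound. *)
Lemma pos_lower_bound (a b : C) : 0 < a -> 0 < b ->
  exists2 c : C, 0 < c & (c <= a) && (c <= b).
Proof.
move=> a0 b0; have ab0 : 0 < a + b by rewrite addr_gt0.
exists (a * b / (a + b)); first by rewrite divr_gt0 ?mulr_gt0.
rewrite !ler_pdivrMr//; apply/andP; split.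
  by rewrite ler_pM2l// ler_wpDl// ltW.
by rewrite mulrC ler_pM2l// ler_wpDr// ltW.
Qed.

Lemma coef_bound p : exists2 G : C, 0 < G & forall i, `|p`_i| <= G.
Proof.
exists (1 + \sum_(i < size p) `|p`_i|).
  by rewrite ltr_pwDl// sumr_ge0.
move=> i; have [ip|pi] := ltnP i (size p); last first.
  by rewrite nth_default// normr0 addr_ge0// sumr_ge0.
rewrite (bigD1 (Ordinal ip))//= addrCA ler_wpDr// addr_ge0// sumr_ge0//.
Qed.

Lemma horner_le_coef p (delta B y : C) : 0 <= delta -> 1 <= B -> `|y| <= B ->
  (forall i, `|p`_i| <= delta) -> `|p.[y]| <= delta * ((size p)%:R * B ^+ size p).
Proof.
move=> d0 B1 yB pd; rewrite horner_coef (le_trans (ler_norm_sum _ _ _))//.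
rewrite mulrCA mulr_natl -[X in _ *+ X](card_ord (size p)) -sumr_const.
apply: ler_sum => i _; rewrite normrM normrX ler_pM ?exprn_ge0//.
apply: (@le_trans _ _ (B ^+ i)); first by rewrite lerXn2r// nnegrE// (le_trans ler01).
by rewrite ler_weXn2l// ltnW.
Qed.

(** Division by [X - z] is continuous: the quotient [p] of [r] satisfies the
    descending recursion [p_i = r_(i+1) + z p_(i+1)]. *)
Lemma coef_div_XsubC p (z rho B : C) : 0 <= rho -> 1 <= B -> `|z| <= B ->
  (forall i, `|(('X - z%:P) * p)`_i| <= rho) ->
  forall i, `|p`_i| <= rho * ((size p)%:R * B ^+ size p).
Proof.
move=> r0 B1 zB H; have B0 : 0 <= B by rewrite (le_trans ler01).
have rec i : p`_i = (('X - z%:P) * p)`_i.+1 + z * p`_i.+1.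
  by rewrite mulrBl coefB coefXM coefCM/= subrK.
have K k : (k <= size p)%N -> `|p`_(size p - k)| <= rho * (k%:R * B ^+ k).
  elim: k => [_|k IH ks]; first by rewrite subn0 nth_default// normr0 mul0r mulr0.
  rewrite rec -subSn// subSS (le_trans (ler_normD _ _))// normrM.
  have := IH (ltnW ks) => {}IH.
  rewrite -natr1 [in leRHS]mulrDl mul1r mulrDr addrC lerD//.
    apply: le_trans (ler_pM _ _ zB IH) _ => //.
    by rewrite exprSr mulrC !mulrA.
  by apply: le_trans (H _) _; rewrite ler_peMr// exprn_ege1.
move=> i; have [ip|pi] := ltnP i (size p); last first.
  by rewrite nth_default// normr0 !mulr_ge0// exprn_ge0.
rewrite -(subKn (ltnW ip)); apply: le_trans (K _ (leq_subr _ _)) _.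
rewrite ler_wpM2l// ler_pM ?exprn_ge0// ?ler_nat ?leq_subr//.
by rewrite ler_weXn2l// leq_subr.
Qed.

(** A product of [size zs] factors [|y - z|] cannot be smaller than
    [eta ^ size zs] unless one of the factors is smaller than [eta]. *)
Lemma near_root zs (y eta : C) : 0 < eta ->
  `|(rootprod zs).[y]| < eta ^+ size zs -> exists2 z, z \in zs & `|y - z| < eta.
Proof.
move=> eta0; rewrite horner_prod => small.
have [/hasP[z zzs yz]|/hasPn H] := boolP (has (fun z => `|y - z| < eta) zs); first by exists z.
suff A : eta ^+ size zs <= `|\prod_(z <- zs) (('X - z%:P).[y])|.
  by have := le_lt_trans A small; rewrite ltxx.
elim: zs H {small} => [|z zs IH] H; first by rewrite big_nil normr1.
rewrite big_cons normrM exprS ler_pM ?exprn_ge0//; try exact: ltW.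
  rewrite hornerXsubC.
  have [//|lt] := real_leP (gtr0_real eta0) (normr_real (y - z)).
  by have := H z (mem_head _ _); rewrite lt.
by apply: IH => t tz; apply: H; rewrite in_cons tz orbT.
Qed.

(** Roots are removed one at a time.  When the coefficients of
    [rootprod zs] are close to those of [rootprod (y :: ys)], its value at [y]
    is small, so some root [z] is close to [y] and is in [U] if [y] is.  The
    quotients by [X - z] and [X - y] are then close again, because

      [(X - z) (h' - g') = (h - g) + (z - y) g']

    for [h = (X - z) h'] and [g = (X - y) g'], so the induction hypothesis
    applies to the remaining roots. *)
Lemma count_roots_lsc (U : pred C) :
  (forall y, U y -> exists2 eta : C, 0 < eta & forall z, `|y - z| < eta -> U z) ->
  forall ys, exists2 delta : C, 0 < delta & forall zs, size zs = size ys ->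
    (forall i, `|(rootprod zs)`_i - (rootprod ys)`_i| <= delta) ->
    (count U ys <= count U zs)%N.
Proof.
move=> Uo; elim=> [|y ys [d' d'0 IH]]; first by exists 1.
have [eta eta0 etaU] : exists2 eta : C, 0 < eta &
    forall z, `|y - z| < eta -> (U y <= U z)%N.
  case Uy : (U y); last by exists 1.
  by have [eta eta0 H] := Uo _ Uy; exists eta => // z /H ->.
have [G G0 HG] := coef_bound (rootprod ys).
pose B : C := `|y| + 1; have B1 : 1 <= B by rewrite ler_wpDl.
have B0 : 0 < B by rewrite (lt_le_trans ltr01).
(* D bounds both the evaluation at y and the division by X - z. *)
pose D : C := (size ys).+2%:R * B ^+ (size ys).+2.
have D0 : 0 < D by rewrite mulr_gt0// exprn_gt0.
have e0 : 0 < d' / D / 2 / G by rewrite !divr_gt0.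
(* e2 is how close z has to be to y: within the neighbourhood of y in U, within
   distance 1 so that |z| <= B, and so that (z - y) g' costs half of d' / D. *)
have [e1 e10 /andP[e1eta e1G]] := pos_lower_bound eta0 e0.
have [e2 e20 /andP[e2e1 e21]] := pos_lower_bound e10 ltr01.
have x0 : 0 < (e2 : C) ^+ (size ys).+1 / D / 2 by rewrite !divr_gt0// exprn_gt0.
have x1 : 0 < d' / D / 2 by rewrite !divr_gt0.
have [delta delta0 /andP[dx dy]] := pos_lower_bound x0 x1.
exists delta => // zs szs H.
have Hs (p q : {poly C}) (m : nat) : (size p <= m)%N -> (size q <= m)%N ->
    (size (p - q)%R <= m)%N.
  by move=> pm qm; rewrite (leq_trans (size_polyD _ _))// size_polyN geq_max pm.
have DD m : (m <= (size ys).+2)%N -> m%:R * B ^+ m <= D.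
  by move=> mn; rewrite ler_pM ?exprn_ge0 ?ler_nat ?ler_weXn2l// ltW.
have [z zzs yz] : exists2 z, z \in zs & `|y - z| < e2.
  apply: near_root => //.
  have -> : (rootprod zs).[y] = (rootprod zs - rootprod (y :: ys)).[y].
    by rewrite hornerD hornerN rootprod_cons hornerM hornerXsubC subrr mul0r subr0.
  apply: (@le_lt_trans _ _ (delta * D)).
    apply: le_trans (@horner_le_coef _ delta B y _ _ _ _) _ => //.
    - exact: ltW.
    - by rewrite ler_wpDr.
    - by move=> i; rewrite coefB H.
    rewrite ler_pM2l// DD// Hs ?size_rootprod// szs//.
  rewrite -ltr_pdivlMr// (le_lt_trans dx)// szs ltr_pdivrMr//.
  rewrite mulr_natr mulr2n ltrDl divr_gt0// exprn_gt0//.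
have pz := perm_to_rem zzs; rewrite (permP pz)/=.
have sr : size (rem z zs) = size ys by rewrite size_rem// szs.
rewrite leq_add//; first by apply: etaU; rewrite (lt_le_trans yz)// (le_trans e2e1).
apply: IH => // i; rewrite -coefB.
have Ez : rootprod zs = ('X - z%:P) * rootprod (rem z zs).
  by rewrite /rootprod (perm_big _ pz) big_cons.
have Ed : ('X - z%:P) * (rootprod (rem z zs) - rootprod ys) =
    (rootprod zs - rootprod (y :: ys)) + (z - y)%:P * rootprod ys.
  rewrite Ez rootprod_cons polyCB; ring.
apply: le_trans (@coef_div_XsubC _ z (d' / D) B _ _ _ _ i) _ => //.
- by rewrite divr_ge0// ltW.
- have -> : z = y + (z - y) by rewrite addrC subrK.
  rewrite (le_trans (ler_normD _ _))// lerD2l (le_trans _ e21)// distrC ltW//.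
- move=> j; rewrite Ed coefD (le_trans (ler_normD _ _))//.
  rewrite [leRHS](splitr (d' / D)) lerD//; first by rewrite coefB (le_trans (H _)).
  rewrite coefCM normrM; apply: (@le_trans _ _ (d' / D / 2 / G * G)).
    by rewrite ler_pM// distrC (le_trans (ltW yz))// (le_trans e2e1).
  by rewrite divfK// gt_eqF.
- have sz : (size (rootprod (rem z zs) - rootprod ys)%R <= (size ys).+2)%N.
    by rewrite Hs// size_rootprod ?sr.
  rewrite -[leRHS](divfK (lt0r_neq0 D0)) ler_pM2l ?divr_gt0// DD//.
Qed.
End root_continuity.

(** * Critical points of polynomials with roots on the unit circle *)

Section critical_points.
Variable C : numClosedFieldType.
Implicit Types (xs rs : seq C) (x z : C).

Lemma deriv_rootprod_cons x xs :
  (rootprod (x :: xs))^`() = rootprod xs + ('X - x%:P) * (rootprod xs)^`().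
Proof. by rewrite rootprod_cons derivM derivXsubC mul1r. Qed.

(** With [w = z / (z - x)] one has [w - 1 = x / (z - x)], so [|x| < |z|] says that
    [w] is closer to 1 than to 0, that is [1/2 < Re w]. *)
Lemma Re_div_sub_gt0 z x : `|x| = 1 -> 1 < `|z| -> 0 < 'Re (z / (z - x)).
Proof.
move=> x1 z1.
have zx0 : z - x != 0.
  by apply: contraTneq z1 => /subr0_eq ->; rewrite x1 ltxx.
set w := z / _.
have w1 : `|w - 1| < `|w|.
  have -> : w - 1 = x / (z - x) by rewrite /w; field.
  by rewrite /w !normrM ltr_pM2r ?normr_gt0 ?invr_eq0// x1.
have : `|w - 1| ^+ 2 < `|w| ^+ 2 by rewrite ltrXn2r.
rewrite !normCK rmorphB rmorph1.
have -> : (w - 1) * (w^* - 1) = w * w^* - (w + w^*) + 1 by ring.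
rewrite -subr_gt0 /= => H.
have {}H : 1 < w + w^*.
  by rewrite -subr_gt0; move: H; congr (_ < _); ring.
by rewrite ReE divr_gt0// (lt_trans _ H).
Qed.

(** Gauss-Lucas for the unit disc: [z f'(z) / f(z)] is the sum of the
    [z / (z - x)], all of which have positive real part. *)
Lemma deriv_rootprod_neq0 z xs : (forall x, x \in xs -> `|x| = 1) ->
  xs != [::] -> 1 < `|z| -> (rootprod xs)^`().[z] != 0.
Proof.
move=> xs1 xs0 z1.
have [f0 [L [E L0 Lp]]] : (rootprod xs).[z] != 0 /\
   exists L, [/\ (rootprod xs)^`().[z] * z = L * (rootprod xs).[z],
    0 <= 'Re L & xs != [::] -> 0 < 'Re L].
  elim: xs xs1 {xs0} => [|x xs IH] xs1.
    rewrite /rootprod big_nil hornerC oner_eq0; split=> //.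
    by exists 0; rewrite derivC horner0 !mul0r raddf0.
  have [|f0 [L [E L0 _]]] := IH.
    by move=> t tx; apply: xs1; rewrite in_cons tx orbT.
  have x1 : `|x| = 1 by apply: xs1; rewrite mem_head.
  have zx0 : z - x != 0.
    by apply: contraTneq z1 => /subr0_eq ->; rewrite x1 ltxx.
  split; first by rewrite rootprod_cons hornerM hornerXsubC mulf_neq0.
  have Lp : 0 < 'Re (z / (z - x) + L).
    by rewrite raddfD/= ltr_pwDl// Re_div_sub_gt0.
  exists (z / (z - x) + L); split => //; last exact: ltW.
  rewrite deriv_rootprod_cons rootprod_cons hornerD !hornerM !hornerXsubC.
  move: E; set F := (rootprod xs).[z]; set F' := _.[z] => E.
  have -> : (F + (z - x) * F') * z = F * z + (z - x) * (F' * z) by ring.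
  by rewrite E; field.
apply: contraTneq (Lp xs0) => fz; move: E; rewrite fz mul0r => /esym/eqP.
by rewrite mulf_eq0 (negPf f0) orbF => /eqP ->; rewrite raddf0 ltxx.
Qed.

(** [f'(0) / f(0) = - sum_x 1 / x], where [1 / x] is the conjugate of [x]. *)
Lemma norm_deriv_rootprod0 xs : (forall x, x \in xs -> `|x| = 1) ->
  `|(rootprod xs)^`().[0]| = `|\sum_(x <- xs) x|.
Proof.
move=> xs1.
have [f1 E] : `|(rootprod xs).[0]| = 1 /\
    (rootprod xs)^`().[0] = - (rootprod xs).[0] * (\sum_(x <- xs) x)^*.
  elim: xs xs1 => [|x xs IH] xs1.
    rewrite /rootprod !big_nil hornerC normr1; split=> //.
    by rewrite derivC horner0 rmorph0 mulr0.
  have [|f0 E] := IH.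
    by move=> t tx; apply: xs1; rewrite in_cons tx orbT.
  have x1 : `|x| = 1 by apply: xs1; rewrite mem_head.
  rewrite deriv_rootprod_cons rootprod_cons hornerD !hornerM !hornerXsubC sub0r.
  rewrite E big_cons normrM normrN x1 f0 mulr1 rmorphD/=; split => //.
  have xx : x * x^* = 1 by rewrite -normCK x1 expr1n.
  rewrite mulrDr; congr (_ + _); last by ring.
  by rewrite !mulNr opprK mulrAC xx mul1r.
by rewrite E normrM normrN f1 mul1r norm_conjC.
Qed.

Lemma prod_norm_le (a : pred C) (q : C) rs : 0 <= q ->
  (forall r, r \in rs -> `|r| <= 1) -> (forall r, r \in rs -> a r -> `|r| <= q) ->
  \prod_(r <- rs) `|r| <= q ^+ count a rs.
Proof.
move=> q0; elim: rs => [|r rs IH] H1 Hq; first by rewrite big_nil.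
rewrite big_cons /= exprD ler_pM ?prodr_ge0//; last first.
  by apply: IH => t tr; [apply: H1|apply: Hq]; rewrite in_cons tr orbT.
by case: (boolP (a r)) => ar; [rewrite Hq ?mem_head|rewrite H1 ?mem_head].
Qed.

Lemma coef_deriv_rootprod_last xs :
  (rootprod xs)^`()`_(size xs).-1 = (size xs)%:R.
Proof.
case: xs => [|x xs]; first by rewrite /rootprod big_nil derivC coef0.
rewrite coef_deriv /=; have /monicP := monic_prod_XsubC (x :: xs) predT id.
by rewrite lead_coefE size_prod_XsubC /= => ->.
Qed.

Lemma size_deriv_rootprod xs : size (rootprod xs)^`() = size xs.
Proof.
case: xs => [|x xs]; first by rewrite /rootprod big_nil derivC size_poly0.
apply/eqP; rewrite eqn_leq; apply/andP; split.
  rewrite -ltnS -(size_rootprod (x :: xs)) lt_size_deriv// -size_poly_eq0 size_rootprod//.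
rewrite ltnNge; apply/negP => /leq_sizeP/(_ (size xs) (leqnn _)) H.
have := coef_deriv_rootprod_last (x :: xs).
by rewrite H => /esym/eqP; rewrite pnatr_eq0.
Qed.

Lemma lead_coef_deriv_rootprod xs :
  lead_coef (rootprod xs)^`() = (size xs)%:R.
Proof. by rewrite lead_coefE size_deriv_rootprod coef_deriv_rootprod_last. Qed.

(** The deterministic core of the proof: critical points far inside the disc
    force the sum of the roots to be exponentially small in their number. *)
Lemma norm_sum_le_critical (a : pred C) (q : C) xs rs : 0 <= q ->
  xs != [::] -> (forall x, x \in xs -> `|x| = 1) ->
  (rootprod xs)^`() = lead_coef (rootprod xs)^`() *: rootprod rs ->
  (forall r, `|r| <= 1 -> a r -> `|r| <= q) ->
  `|\sum_(x <- xs) x| <= (size xs)%:R * q ^+ count a rs.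
Proof.
move=> q0 xs0 xs1 E aq.
have lc0 : lead_coef (rootprod xs)^`() != 0.
  by rewrite lead_coef_deriv_rootprod pnatr_eq0 -leqn0 leqNgt lt0n size_eq0 xs0.
have r1 r : r \in rs -> `|r| <= 1.
  move=> rrs; have [//|] := real_leP (normr_real r) (@real1 C).
  move=> /(deriv_rootprod_neq0 xs1 xs0); rewrite E hornerZ mulf_eq0 (negPf lc0)/=.
  by rewrite -rootE root_prod_XsubC rrs.
rewrite -norm_deriv_rootprod0// E hornerZ normrM lead_coef_deriv_rootprod normr_nat.
rewrite ler_wpM2l// horner_prod normr_prod.
have -> : \prod_(r <- rs) `|('X - r%:P).[0]| = \prod_(r <- rs) `|r|.
  by apply: eq_bigr => r _; rewrite hornerXsubC sub0r normrN.
by apply: prod_norm_le => // r rrs; apply: aq; apply: r1.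
Qed.

End critical_points.

(** * Measurability of root counts *)

Section complex_norm.
Variable R : realType.

Lemma norm_i : `|'i%C| = 1 :> R[i].
Proof. by rewrite normc_def/= expr0n expr1n/= add0r sqrtr1. Qed.

Lemma norm_complex_lt (z : R[i]) (e : R) :
  `|complex.Re z| < e / 2 -> `|complex.Im z| < e / 2 -> `|z| < e%:C.
Proof.
move=> a b; rewrite {1}(complexE z) (le_lt_trans (ler_normD _ _))// normrM norm_i.
rewrite mul1r !normc_def /= !expr0n/= !addr0 !sqrtr_sqr -rmorphD/= ltcR; lra.
Qed.

End complex_norm.

Section measurability.
Context d (T : measurableType d) (R : realType).

Lemma measurable_norm_lt (F : T -> R) (s : R) : measurable_fun setT F ->
  measurable [set w | `|F w| < s].
Proof.
move=> mF; have -> : [set w | `|F w| < s] = setT `&` F @^-1` `]- s, s[.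
  by rewrite setTI; apply/seteqP; split => w /=; rewrite in_itv/= ltr_norml.
by apply: (mF measurableT); exact: measurable_itv.
Qed.

(** [A] is open for the topology induced by finitely many measurable functions
    [c i]; it is then the union of the countably many boxes with rational
    centre and radius that it contains. *)
Lemma measurable_coordinate_open (I : finType) (c : I -> T -> R) (A : set T) :
  (forall i, measurable_fun setT (c i)) ->
  (forall w, A w -> exists2 delta : R, 0 < delta &
     forall w', (forall i, `|c i w' - c i w| < delta) -> A w') ->
  measurable A.
Proof.
move=> mc Ao.
pose box (q : {ffun I -> rat}) (s : rat) :=
  [set w | forall i, `|c i w - ratr (q i)| < ratr s].
have mbox q s : measurable (box q s).
  have -> : box q s = \bigcap_(i in [set: I])
      [set w | `|c i w - ratr (q i)| < ratr s].
    by apply/seteqP; split => w /= H i; [move=> _|]; apply: H.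
  apply: fin_bigcap_measurable => // i _.
  apply: measurable_norm_lt; apply: measurable_funB; first exact: mc.
  exact: measurable_cst.
have -> : A = \bigcup_(p : {ffun I -> rat} * rat)
    [set w | box p.1 p.2 w /\ box p.1 p.2 `<=` A].
  apply/seteqP; split => [w Aw|w [[q s] _ /= [qw]]]; last by apply.
  have [delta d0 H] := Ao _ Aw.
  have [s s0 sd] : exists2 s : rat, 0 < (ratr s : R) & (ratr s : R) *+ 2 < delta.
    have : 0 < delta / 2 by rewrite divr_gt0.
    move=> /rat_in_itvoo[s]; rewrite in_itv/= => /andP[s0 sd].
    by exists s => //; rewrite -mulr_natr -ltr_pdivlMr.
  have /choice[q Hq] : forall i, exists q : rat, `|c i w - ratr q| < ratr s.
    move=> i; have : c i w - ratr s < c i w + ratr s by rewrite ltrD2l gtrN.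
    move=> /rat_in_itvoo[q]; rewrite in_itv/= => /andP[q1 q2].
    by exists q; rewrite ltr_distlC; lra.
  exists (finfun q, s) => //=; split; first by move=> i; rewrite ffunE.
  move=> w' Hw'; apply: H => i; apply: lt_trans sd.
  have := Hw' i; rewrite ffunE distrC mulr2n => h.
  have -> : c i w' - c i w = (c i w' - ratr (q i)) - (c i w - ratr (q i)) by lra.
  by rewrite (le_lt_trans (ler_normB _ _))// ltrD// distrC.
apply: countable_bigcupT_measurable => // -[q s] /=.
have [sub|nsub] := pselect (box q s `<=` A).
  have -> : [set w | box q s w /\ box q s `<=` A] = box q s.
    by apply/seteqP; split => [w []//|w ?]; split.
  exact: mbox.
have -> : [set w | box q s w /\ box q s `<=` A] = set0.
  by rewrite -subset0 => w [].
exact: measurable0.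
Qed.

(** Measurability of complex functions by coordinates, for which differences and
    products reduce to the real case. *)
Definition cmeasurable (F : T -> R[i]) :=
  measurable_fun setT (fun w => complex.Re (F w)) /\
  measurable_fun setT (fun w => complex.Im (F w)).

Lemma cmeasurable_cst (z : R[i]) : cmeasurable (fun=> z).
Proof. by split; exact: measurable_cst. Qed.

Lemma cmeasurableB F G : cmeasurable F -> cmeasurable G ->
  cmeasurable (fun w => F w - G w).
Proof.
move=> [F1 F2] [G1 G2]; split.
  under eq_fun do rewrite raddfB/=; exact: measurable_funB.
under eq_fun do rewrite raddfB/=; exact: measurable_funB.
Qed.

Lemma cmeasurableM F G : cmeasurable F -> cmeasurable G ->
  cmeasurable (fun w => F w * G w).
Proof.
move=> [F1 F2] [G1 G2]; split.
  apply: (eq_measurable_fun (fun w => complex.Re (F w) * complex.Re (G w)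
     - complex.Im (F w) * complex.Im (G w))).
    by move=> w _; case: (F w) => a b; case: (G w).
  by apply: measurable_funB; exact: measurable_funM.
apply: (eq_measurable_fun (fun w => complex.Re (F w) * complex.Im (G w)
     + complex.Im (F w) * complex.Re (G w))).
  by move=> w _; case: (F w) => a b; case: (G w).
by apply: measurable_funD; exact: measurable_funM.
Qed.

Lemma cmeasurable_coef_rootprod (X : nat -> T -> R[i]) (js : seq nat) k :
  (forall j, cmeasurable (X j)) ->
  cmeasurable (fun w => (rootprod [seq X j w | j <- js])`_k).
Proof.
move=> mX; elim: js k => [|j js IH] k.
  rewrite /rootprod/=; under eq_fun do rewrite big_nil.
  exact: cmeasurable_cst.
under eq_fun do rewrite rootprod_cons mulrBl coefB coefXM coefCM.
apply: cmeasurableB; last exact: cmeasurableM.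
by case: k => [|k]/=; [exact: cmeasurable_cst|exact: IH].
Qed.

(** By [count_roots_lsc] the event is open in the coefficients of [g w],
    whatever the order, measurable or not, in which [rs w] lists the roots. *)
Lemma measurable_count_roots (g : T -> {poly R[i]}) (rs : T -> seq R[i])
    (U : pred R[i]) (n m : nat) :
  (forall k, cmeasurable (fun w => (g w)`_k)) ->
  (forall w, size (rs w) = n) ->
  (exists2 a : R[i], a != 0 & forall w, g w = a *: rootprod (rs w)) ->
  (forall y, U y -> exists2 eta : R[i], 0 < eta & forall z, `|y - z| < eta -> U z) ->
  measurable [set w | (m <= count U (rs w))%N].
Proof.
move=> mg sz [a a0 grs] Uo.
(* Real and imaginary parts of the coefficients are the coordinates to which
   measurable_coordinate_open is applied. *)
pose c (i : 'I_n.+1 * bool) w :=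
  (if i.2 then complex.Re (g w)`_i.1 else complex.Im (g w)`_i.1) : R.
apply: (@measurable_coordinate_open _ c).
  by move=> [i []]; rewrite /c/=; have [] := mg i.
move=> w /= mw; have [delta d0 H] := count_roots_lsc Uo (rs w).
have da0 : 0 < delta * `|a| by rewrite mulr_gt0// normr_gt0.
have /complex_realP[e Ee] := gtr0_real da0.
have e0 : 0 < e by move: da0; rewrite Ee ltcR.
exists (e / 2); first by rewrite divr_gt0.
move=> w' Hw'; rewrite (leq_trans mw)// H ?sz// => i.
have [ilt|ige] := ltnP i n.+1; last first.
  by rewrite !nth_default ?size_rootprod ?sz// subrr normr0 ltW.
rewrite -(ler_pM2r (_ : 0 < `|a|)) ?normr_gt0// -normrM mulrBl.
rewrite ![_ * a]mulrC -!coefZ -!grs Ee ltW// norm_complex_lt//.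
  by have := Hw' (Ordinal ilt, true); rewrite /c/= raddfB.
by have := Hw' (Ordinal ilt, false); rewrite /c/= raddfB.
Qed.

Lemma measurable_fun_count (N : T -> nat) (n : nat) :
  (forall w, (N w <= n)%N) -> (forall m, measurable [set w | (m <= N w)%N]) ->
  measurable_fun setT (fun w => (N w)%:R : R).
Proof.
move=> Nn mN.
apply: (eq_measurable_fun (fun w => \sum_(i <- iota 0 n) (\1_[set w | (i < N w)%N] w : R))).
  move=> w _; rewrite (eq_bigr (fun i => (i < N w)%N%:R)); last first.
    by move=> i _; rewrite indicE mem_setE.
  rewrite -natr_sum; congr (_%:R).
  rewrite -[X in iota _ X]subn0 -/(index_iota 0 n) big_mkord -big_mkcond/=.
  by rewrite -(big_ord_widen n (fun=> 1%N) (Nn w)) sum1_card card_ord.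
by apply: measurable_sum => i; apply: measurable_indic.
Qed.
End measurability.

(** * Small balls for the real part of a uniform point of the circle *)

Section small_ball.
Variable R : realType.

(** The cosine is flattest at the ends of [0, pi].  Put [a = x / 2] and
    [b = y / 2] with [a <= b]: the difference of the two sides is
    [4 sin (b - a) cos b sin a], a product of nonnegative factors. *)
Lemma one_sub_cos_le (x y : R) : 0 <= x <= pi -> 0 <= y <= pi ->
  1 - cos (x - y) <= `|cos x - cos y|.
Proof.
wlog xy : x y / x <= y.
  move=> H hx hy; have [xy|/ltW yx] := leP x y; first exact: H.
  by rewrite distrC -cosN opprB; apply: H.
move=> /andP[x0 xp] /andP[y0 yp]; apply: le_trans (ler_norm _).
have -> : x - y = - ((y / 2 - x / 2) *+ 2) by rewrite mulr2n; lra.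
have -> : cos x = cos ((x / 2) *+ 2) by congr cos; rewrite mulr2n; lra.
have -> : cos y = cos ((y / 2) *+ 2) by congr cos; rewrite mulr2n; lra.
rewrite cosN !cos_mulr2n !mulr2n.
set a := x / 2; set b := y / 2.
have s1 : 0 <= sin (b - a) by rewrite sin_ge0_pi// /a /b; apply/andP; split; lra.
have s2 : 0 <= cos b by rewrite cos_ge0_pihalf// /b; apply/andP; split; lra.
have s3 : 0 <= sin a by rewrite sin_ge0_pi// /a; apply/andP; split; lra.
have h1 := cos2Dsin2 a; have h2 := cos2Dsin2 b; have h3 := cos2Dsin2 (b - a).
have : 0 <= sin (b - a) * (cos b * sin a) by rewrite !mulr_ge0.
have E : sin (b - a) = sin b * cos a - cos b * sin a by rewrite sinB.
have E2 : sin (b - a) ^+ 2 + 2 * (sin (b - a) * (cos b * sin a)) =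
   sin b ^+ 2 - sin a ^+ 2.
  transitivity (sin b ^+ 2 * cos a ^+ 2 - cos b ^+ 2 * sin a ^+ 2).
    by rewrite E; ring.
  have -> : cos a ^+ 2 = 1 - sin a ^+ 2 by lra.
  have -> : cos b ^+ 2 = 1 - sin b ^+ 2 by lra.
  by ring.
lra.
Qed.

Lemma uniform_prob01_le (A : set (measurableTypeR R)) : measurable A ->
  (uniform_prob (@ltr01 R) A <= lebesgue_measure (A `&` `[0%R, 1%R]))%E.
Proof.
move=> mA; rewrite /uniform_prob integral_uniform_pdf.
have mAI : measurable (A `&` `[0%R, 1%R] : set (measurableTypeR R)).
  by apply: measurableI => //; exact: measurable_itv.
rewrite -[leRHS]mul1e -integral_cst//.
apply: ge0_le_integral => //.
- by move=> x _; rewrite lee_fin uniform_pdf_ge0.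
- apply/measurable_EFinP/measurable_funTS; exact: measurable_uniform_pdf.
- by move=> x _; rewrite lee_fin /uniform_pdf; case: ifP; rewrite ?subr0 ?invr1.
Qed.

(** By [one_sub_cos_le], a set of [t] in a half period on which
    [cos (2 pi t)] varies by less than [1 - cos (2 pi L)] has diameter less than
    [L].  The two halves of [0, 1] are exchanged by [t -> 1 - t], so the set at
    hand is covered by two intervals of length [2 L]; take [4 L <= kappa]. *)
Lemma cos_small_ball (kappa : R) : 0 < kappa ->
  exists2 rho : R, 0 < rho & forall c,
   (uniform_prob (@ltr01 R) [set t | (`|cos (2 * pi * t) + c| < rho)%R]
     <= kappa%:E)%E.
Proof.
move=> k0; have pi0 := pi_gt0 R.
have [L L0 /andP[L2 L4]] : exists2 L : R, 0 < L & (L <= 2^-1) && (L <= kappa / 4).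
  by apply: pos_lower_bound; lra.
have cL : cos (2 * pi * L) < 1.
  rewrite -[ltRHS]cos0 ltr_cos ?in_itv/= ?lexx/=; nra.
exists ((1 - cos (2 * pi * L)) / 2); first by lra.
move=> c; set rho := _ / 2; set A := [set t | _].
have mA : measurable A.
  apply: measurable_norm_lt; apply: measurable_funD; last exact: measurable_cst.
  apply: continuous_measurable_fun => t; apply: continuous_comp.
    exact: mulrl_continuous.
  exact: continuous_cos.
apply: le_trans (uniform_prob01_le mA) _.
have pib u : 0 <= u <= 2^-1 -> 0 <= 2 * pi * u <= (pi : R).
  by move=> /andP[u0 u2]; apply/andP; split; nra.
have half t1 t2 : A t1 -> A t2 -> 0 <= t1 <= 2^-1 -> 0 <= t2 <= 2^-1 ->
    `|t1 - t2| < L.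
  rewrite /A/= => A1 A2 h1 h2; rewrite ltNge; apply/negP => Lt.
  have : cos (2 * pi * `|t1 - t2|) <= cos (2 * pi * L).
    have t12 : `|t1 - t2| <= 2^-1 by rewrite ler_norml; apply/andP; split; lra.
    by rewrite leNgt ltr_cos ?in_itv/= -?leNgt ?pib ?ler_wpM2l//
      ?mulr_ge0 ?normr_ge0 ?L2 ?(ltW L0) ?(ltW pi0).
  have -> : cos (2 * pi * `|t1 - t2|) = cos (2 * pi * t1 - 2 * pi * t2).
    by rewrite -mulrBr -[RHS]cos_norm normrM (ger0_norm (_ : 0 <= 2 * pi))//; lra.
  have : 1 - cos (2 * pi * t1 - 2 * pi * t2) <=
      `|cos (2 * pi * t1) - cos (2 * pi * t2)|.
    by apply: one_sub_cos_le; exact: pib.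
  have : `|cos (2 * pi * t1) - cos (2 * pi * t2)| < rho *+ 2.
    have -> : cos (2 * pi * t1) - cos (2 * pi * t2) =
      (cos (2 * pi * t1) + c) - (cos (2 * pi * t2) + c) by ring.
    by rewrite mulr2n (le_lt_trans (ler_normB _ _))// ltrD.
  move=> p1 p2 p3; have := le_lt_trans p2 p1.
  by rewrite /rho -[(_ / _) *+ 2]mulr_natr divfK ?pnatr_eq0// ltrD2l ltrN2 ltNge p3.
have Asym t : A t -> A (1 - t).
  rewrite /A/=; have -> : 2 * pi * (1 - t) = - (2 * pi * t) + pi *+ 2.
    by rewrite mulr2n; ring.
  by rewrite cosD2pi cosN.
have cover (B : set R) : (forall t1 t2, B t1 -> B t2 -> `|t1 - t2| < L) ->
    exists a, B `<=` `[a - L, a + L].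
  move=> HB; have [[a Ba]|nB] := pselect (exists a, B a); last first.
    by exists 0 => t Bt; case: nB; exists t.
  exists a => t Bt /=; rewrite in_itv/=.
  by have := HB _ _ Bt Ba; rewrite ltr_norml => /andP[]; lra.
have [a Ha] := cover (A `&` `[0, 2^-1]) (fun t1 t2 '(conj A1 h1) '(conj A2 h2) =>
  half t1 t2 A1 A2 h1 h2).
have [b Hb] : exists b, A `&` `[2^-1, 1] `<=` `[b - L, b + L].
  apply: cover => t1 t2 [A1]; rewrite /= in_itv/= => h1 [A2]; rewrite in_itv/= => h2.
  have := half _ _ (Asym _ A1) (Asym _ A2).
  have -> : 1 - t1 - (1 - t2) = - (t1 - t2) by ring.
  by rewrite normrN; apply; apply/andP; split; lra.
have mu2 (x : R) : lebesgue_measure `[x - L, x + L] = (L *+ 2)%:E.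
  rewrite lebesgue_measure_itv/= lte_fin ifT; last by lra.
  by rewrite -EFinB mulr2n; congr EFin; lra.
apply: (@le_trans _ _ (lebesgue_measure
   ((`[a - L, a + L] : set (measurableTypeR R)) `|` `[b - L, b + L]))).
  apply: le_measure; rewrite ?inE.
  - by apply: measurableI => //; exact: measurable_itv.
  - by apply: measurableU; exact: measurable_itv.
  - move=> t [At]; rewrite /= in_itv/= => /andP[t0 t1].
    have [t2|/ltW t2] := leP t 2^-1; [left; apply: Ha|right; apply: Hb];
      by split => //=; rewrite in_itv/=; apply/andP.
apply: le_trans (measureU2 _ _ _) _; [exact: measurable_itv..|].
by rewrite /= !mu2 -EFinD lee_fin mulr2n; lra.
Qed.
End small_ball.

(** * Anti-concentration of sums of independent variables *)

Section anti_concentration.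
Context d (T : measurableType d) (R : realType) (P : probability T R).
Variable Y : nat -> T -> R.
Hypothesis mY : forall j, measurable_fun setT (Y j).

(** Cylinders: the events on which mutual independence gives the product
    formula. *)
Definition cyl (js : seq nat) (B : nat -> set R) : set T :=
  [set w | forall j, j \in js -> B j (Y j w)].

Hypothesis indepY : forall (js : seq nat) (B : nat -> set R), uniq js ->
  (forall j, measurable (B j)) ->
  P (cyl js B) = (\prod_(j <- js) P (Y j @^-1` B j))%E.

Lemma measurable_cyl js B : (forall j, measurable (B j)) ->
  measurable (cyl js B).
Proof.
move=> mB; have -> : cyl js B = \bigcap_(j in [set` js]) (Y j @^-1` B j).
  by apply/seteqP; split => w H j; apply: H.
apply: fin_bigcap_measurable => // j _.
by rewrite -[X in measurable X]setTI; exact: mY.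
Qed.

(** Conditionally on all variables but the first, the sum is a translate of
    [Y 0], whose small-ball probability is at most [kappa].  To use nothing but
    the product formula on cylinders, the conditioning is discretized: the
    variables are removed from the last to the first, each being replaced by a
    constant on cells of diameter [delta], at the cost of enlarging the radius
    by [delta].  The cylinder on indices beyond [k] records the cells of the
    variables that are already removed. *)
Lemma anti_concentration (kappa rho delta : R) (k : nat) (c r : R)
    (js : seq nat) (B : nat -> set R) :
  0 <= kappa -> 0 < delta ->
  (forall j x, (P [set w | (`|Y j w + x| < rho)%R] <= kappa%:E)%E) ->
  r + delta *+ k <= rho ->
  uniq js -> (forall j, j \in js -> (k < j)%N) -> (forall j, measurable (B j)) ->
  (P ([set w | (`|\sum_(j < k.+1) Y j w + c| < r)%R] `&` cyl js B)
    <= kappa%:E * \prod_(j <- js) P (Y j @^-1` B j))%E.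
Proof.
move=> kappa0 delta0 small.
have mball (F : T -> R) (x : R) (s : R) : measurable_fun setT F ->
    measurable [set w | `|F w + x| < s].
  move=> mF; apply: measurable_norm_lt; apply: measurable_funD; first exact: mF.
  exact: measurable_cst.
have prod0 (l : seq nat) (B' : nat -> set R) : (0 <= \prod_(j <- l) P (Y j @^-1` B' j))%E.
  by apply: prode_ge0 => j _; exact: measure_ge0.
elim: k c r js B => [|k IH] c r js B rrho ujs js_k mB.
  pose B' (j : nat) := if j == 0%N then [set y : R | `|y + c| < r] else B j.
  have mB' j : measurable (B' j).
    rewrite /B'; case: eqP => // _.
    apply: measurable_norm_lt; apply: measurable_funD; first exact: measurable_id.
    exact: measurable_cst.
  have BB' j : j \in js -> B' j = B j.
    by move=> /js_k; rewrite /B'; case: j.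
  have -> : [set w | (`|\sum_(j < 1) Y j w + c| < r)%R] `&` cyl js B =
      cyl (0%N :: js) B'.
    apply/seteqP; split => w /=; rewrite big_ord1.
      move=> [w1 w2] j; rewrite in_cons => /orP[/eqP ->|jjs]; first by [].
      by rewrite BB'//; exact: w2.
    move=> H; split; first exact: (H 0%N (mem_head _ _)).
    by move=> j jjs; rewrite -BB'//; apply: H; rewrite in_cons jjs orbT.
  rewrite indepY//=; last first.
    by rewrite ujs andbT; apply/negP => /js_k.
  rewrite big_cons (_ : \big[_/_]_(j <- js) P _ = \prod_(j <- js) P (Y j @^-1` B j))%E; last first.
    by rewrite !big_seq; apply: eq_bigr => j /BB' ->.
  apply: lee_wpmul2r => //; apply: le_trans (small 0%N c).
  apply: le_measure; rewrite ?inE; [|exact: mball|].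
    by rewrite -[X in measurable X]setTI; apply: mY.
  by move=> w /= h; rewrite (lt_le_trans h)// -[leLHS]addr0.
(* The cells of mesh delta, numbered by nat so that sigma-additivity applies;
   numbers that are not codes of integers give empty cells. *)
pose cellfun (y : R) : nat := pickle (Num.floor (y / delta)).
pose cell i := [set y : R | cellfun y = i].
have mcell i : measurable (cell i).
  have [[y0 y0i]|ne] := pselect (exists y, cell i y); last first.
    have -> : cell i = set0; last exact: measurable0.
    by rewrite -subset0 => y iy; apply: ne; exists y.
  have -> : cell i = `[(Num.floor (y0 / delta))%:~R * delta,
      (Num.floor (y0 / delta) + 1)%:~R * delta[%classic.
    apply/seteqP; split => y /=; rewrite in_itv/= -ler_pdivlMr// -ltr_pdivrMr// -floor_eq.
      by rewrite /cell/= -y0i /cellfun => /(pcan_inj pickleK) ->.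
    by move=> /eqP E; rewrite /cell/= -y0i /cellfun E.
  exact: measurable_itv.
have cell_diam i y z : cell i y -> cell i z -> `|y - z| < delta.
  rewrite /cell/= => <- /(pcan_inj pickleK) E.
  have := floor_itv (y / delta); rewrite -E.
  have := floor_itv (z / delta); rewrite intrD1 !ler_pdivlMr// !ltr_pdivrMr//.
  rewrite !mulrDl mul1r => /andP[z1 z2] /andP[y1 y2].
  by rewrite ltr_norml; apply/andP; split; lra.
pose E := [set w | (`|\sum_(j < k.+2) Y j w + c| < r)%R] `&` cyl js B.
pose F i := E `&` Y k.+1 @^-1` cell i.
have mYcell i : measurable (Y k.+1 @^-1` cell i).
  by rewrite -[X in measurable X]setTI; apply: mY.
have mE : measurable E.
  apply: measurableI; last exact: measurable_cyl.
  by apply: mball; apply: measurable_sum.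
have mF i : measurable (F i) by apply: measurableI.
have EF : E `<=` \bigcup_i F i.
  by move=> w Ew; exists (cellfun (Y k.+1 w)).
apply: le_trans (measure_sigma_subadditive P mF mE EF) _.
have kjs : k.+1 \notin js by apply/negP => /js_k; rewrite ltnn.
have HF i : (P (F i) <= (kappa%:E * \prod_(j <- js) P (Y j @^-1` B j)) *
    P (Y k.+1 @^-1` cell i))%E.
  have [[y0 y0i]|ne] := pselect (exists y, cell i y); last first.
    have -> : F i = set0; first by rewrite -subset0 => w [_ iy]; apply: ne; exists (Y k.+1 w).
    by rewrite measure0 !mule_ge0.
  pose B' (j : nat) := if j == k.+1 then cell i else B j.
  have mB' j : measurable (B' j) by rewrite /B'; case: eqP.
  have BB' j : j \in js -> B' j = B j.
    by rewrite /B'; case: eqP => // ->; rewrite (negPf kjs).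
  have B'k : B' k.+1 = cell i by rewrite /B' eqxx.
  have := IH (c + y0) (r + delta) (k.+1 :: js) B'.
  rewrite big_cons (_ : \big[_/_]_(j <- js) P _ = \prod_(j <- js) P (Y j @^-1` B j))%E; last first.
    by rewrite !big_seq; apply: eq_bigr => j /BB' ->.
  rewrite B'k muleCA muleC => IH'; apply: le_trans (IH' _ _ _ _) => //.
  - apply: le_measure; rewrite ?inE//.
      apply: measurableI; last exact: measurable_cyl.
      by apply: mball; apply: measurable_sum.
    move=> w [[/= Sr wB] wi]; split.
      move: Sr; rewrite big_ord_recr/= => Sr.
      have -> : \sum_(j < k.+1) Y j w + (c + y0) =
        (\sum_(j < k.+1) Y j w + Y k.+1 w + c) - (Y k.+1 w - y0) by ring.
      by rewrite (le_lt_trans (ler_normB _ _))// ltrD// (cell_diam i).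
    move=> j; rewrite in_cons => /orP[/eqP ->|jjs]; first by rewrite /B' eqxx.
    by rewrite BB'//; exact: wB.
  - by rewrite -addrA -mulrS.
  - by rewrite /= kjs.
  - by move=> j; rewrite in_cons => /orP[/eqP ->//|/js_k /ltnW].
apply: le_trans (lee_nneseries _ (fun i _ => HF i)) _ => //.
have [K KE] : exists K : R, (kappa%:E * \prod_(j <- js) P (Y j @^-1` B j))%E = K%:E.
  exists (fine (kappa%:E * \prod_(j <- js) P (Y j @^-1` B j)))%E; rewrite fineK//.
  rewrite fin_numM//; apply: prode_fin_num => j _.
  apply: fin_num_measure; rewrite -[X in measurable X]setTI; exact: mY.
rewrite KE nneseriesZl// -[leRHS]mule1 lee_wpmul2l//; first by rewrite -KE mule_ge0.
have -> : \big[+%E/0%R]_(0 <= i <oo) P (Y k.+1 @^-1` cell i) = P (\bigcup_i (Y k.+1 @^-1` cell i)).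
  rewrite measure_bigcup//.
    by apply: eq_eseriesl => i; rewrite in_setT.
  by move=> i j _ _ [w [/= <- <-]].
by apply: probability_le1; exact: bigcupT_measurable.
Qed.
End anti_concentration.

(** * Root distributions and Borel functions on the plane *)

Section root_distribution.
Variable R : realType.

Lemma poly_roots_eq (p : {poly R[i]}) : p = lead_coef p *: rootprod (poly_roots p).
Proof. by rewrite /poly_roots; case: closed_field_poly_normal. Qed.

Lemma size_poly_roots (p : {poly R[i]}) : p != 0 -> size (poly_roots p) = (size p).-1.
Proof.
move=> p0; rewrite [in RHS](poly_roots_eq p) size_scale ?lead_coef_eq0//.
by rewrite size_rootprod.
Qed.

(** For the zero polynomial, [poly_roots] is arbitrary; there the factor [0^-1 = 0]
    makes both sides vanish. *)
Lemma fine_root_dist (p : {poly R[i]}) (U : pred R[i]) :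
  fine (root_dist p [set z | U z]) =
  ((size p).-1%:R)^-1 * (count U (poly_roots p))%:R.
Proof.
rewrite /root_dist/= /mscale/= /msum/=.
have [->|p0] := eqVneq p 0.
  by rewrite size_poly0/= big_ord0 mule0 invr0 mul0r.
rewrite -(size_poly_roots p0); set rs := poly_roots p.
have -> : (\sum_(k < size rs) \d_(rs`_k : borelC R) [set z | U z] =
    ((count U rs)%:R : R)%:E)%E.
  rewrite (eq_bigr (fun k : 'I_(size rs) => ((U rs`_k)%:R : R)%:E)); last first.
    by move=> k _; rewrite diracE mem_setE.
  rewrite sumEFin -natr_sum; congr (_%:R%:E).
  by rewrite -sumn_count sumnE big_map (big_nth 0) big_mkord.
by rewrite -EFinM.
Qed.

Lemma measurable_continuous_borelC (F : R[i] -> R) :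
  (forall z (e : R), 0 < e -> exists2 delta : R[i], 0 < delta &
     forall t, `|z - t| < delta -> `|F z - F t| < e) ->
  measurable_fun [set: borelC R] (F : borelC R -> R).
Proof.
move=> cF.
apply: (@measurability _ _ (borelC R) _ setT F _ (RGenOInfty.measurableE R)).
move=> _ [_ [a ->] <-]; rewrite setTI.
apply: sub_sigma_algebra => /=.
rewrite openE => z /=; rewrite in_itv/= andbT => az.
have [|delta d0 H] := cF z (F z - a); first by rewrite subr_gt0.
apply/nbhs_ballP; exists delta => //= t; rewrite /ball/= => /H.
by rewrite in_itv/= andbT ltr_norml => /andP[_]; lra.
Qed.

Lemma measurable_Re :
  measurable_fun [set: borelC R] (fun z : borelC R => complex.Re (z : R[i])).
Proof.
apply: (@measurable_continuous_borelC (@complex.Re R)) => z e e0.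
exists (e%:C) => [|t]; first by rewrite ltcR.
by rewrite -raddfB -ltcR; apply: le_lt_trans; exact: normc_ge_Re.
Qed.

Lemma measurable_Im :
  measurable_fun [set: borelC R] (fun z : borelC R => complex.Im (z : R[i])).
Proof.
apply: (@measurable_continuous_borelC (@complex.Im R)) => z e e0.
exists (e%:C) => [|t]; first by rewrite ltcR.
rewrite -raddfB -ltcR; apply: le_lt_trans.
by have := normc_ge_Re ((z - t) * 'i%C); rewrite ReiNIm normrN normrM norm_i mulr1.
Qed.

Lemma off_circle_open (eps : R) (y : R[i]) : eps%:C < `| `|y| - 1 | ->
  exists2 eta : R[i], 0 < eta &
    forall z, `|y - z| < eta -> eps%:C < `| `|z| - 1 |.
Proof.
move=> Uy; exists (`| `|y| - 1 | - eps%:C); first by rewrite subr_gt0.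
move=> z; rewrite ltrBrDr -ltrBrDl => /lt_le_trans; apply.
rewrite lerBlDr.
have -> : `|y| - 1 = (`|z| - 1) + (`|y| - `|z|) by ring.
rewrite (le_trans (ler_normD _ _))// lerD2l; exact: ler_dist_dist.
Qed.

(** The maximum with 1/2 keeps the bound positive when [eps >= 1]. *)
Lemma off_circle_le (eps : R) (r : R[i]) : `|r| <= 1 ->
  eps%:C < `| `|r| - 1 | -> `|r| <= (Num.max (1 - eps) 2^-1)%:C.
Proof.
move=> r1; rewrite ler0_norm ?subr_le0// opprB normc_def.
by rewrite -(rmorph1 (real_complex R)) -rmorphB/= ltcR lecR le_max => ?; apply/orP; left; lra.
Qed.

End root_distribution.

(** Write [q = s ^ 2] with [s = 1 / (1 + h)].  Bernoulli gives
    [s ^ N * (N h) <= 1], hence [q ^ N * (N h) ^ 2 <= 1]: since [N > e m] this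
    decay in [m ^ -2] beats the factor [m + 1]. *)
Lemma exp_decay (R : realType) (q e r : R) : 0 < q < 1 -> 0 < e -> 0 < r ->
  exists n0, forall m N : nat, (n0 <= m)%N -> e < m%:R^-1 * N%:R ->
    m.+1%:R * q ^+ N < r.
Proof.
move=> /andP[q0 q1] e0 r0.
pose s := Num.sqrt q; have s0 : 0 < s by rewrite sqrtr_gt0.
have s1 : s < 1 by rewrite -sqrtr1 ltr_sqrt.
pose h := s^-1 - 1; have h0 : 0 < h by rewrite subr_gt0 invf_gt1.
have bern N : 1 + N%:R * h <= (1 + h) ^+ N.
  elim: N => [|N IH]; first by rewrite mul0r addr0.
  rewrite exprS; apply: (@le_trans _ _ ((1 + h) * (1 + N%:R * h))).
    rewrite -natr1; have := ler0n R N; nra.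
  by rewrite ler_wpM2l// addr_ge0// ltW.
have bound N : q ^+ N * (N%:R * h) ^+ 2 <= 1.
  have -> : q = s ^+ 2 by rewrite sqr_sqrtr// ltW.
  rewrite -exprM mulnC exprM -exprMn exprn_ile1//.
    by rewrite mulr_ge0 ?exprn_ge0 ?mulr_ge0// ltW.
  have E1 : s ^+ N * (1 + h) ^+ N = 1.
    by rewrite -exprMn /h addrC subrK divff ?expr1n ?gt_eqF.
  rewrite -[leRHS]E1 ler_wpM2l ?exprn_ge0 ?(ltW s0)//.
  by rewrite (le_trans _ (bern N))// ler_wpDl.
pose K := 2 / (r * (e * h) ^+ 2).
have [n0 Hn0] : exists n0 : nat, K < n0%:R.
  by exists (Num.bound K); rewrite archi_boundP// /K divr_ge0// mulr_ge0 ?sqr_ge0// ltW.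
exists n0.+1 => m N mn eN.
have m0 : 0 < (m%:R : R) by rewrite ltr0n (leq_trans _ mn).
have m1 : 1 <= (m%:R : R) by rewrite ler1n (leq_trans _ mn).
have {}eN : e * m%:R < N%:R by rewrite mulrC -ltr_pdivlMl.
have Km : K < m%:R by rewrite (lt_le_trans Hn0)// ler_nat ltnW.
have eh0 : 0 < r * (e * h) ^+ 2 by rewrite mulr_gt0// exprn_gt0// mulr_gt0.
move: Km; rewrite /K ltr_pdivrMr// => Km.
have qN : 0 <= q ^+ N by rewrite exprn_ge0// ltW.
have bN := bound N.
have sq : (e * m%:R * h) ^+ 2 <= (N%:R * h) ^+ 2.
  by rewrite ler_sqr ?nnegrE ?ler_wpM2r ?mulr_ge0// ltW.
have b1 : q ^+ N * (e * m%:R * h) ^+ 2 <= 1.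
  by rewrite (le_trans _ bN)// ler_wpM2l.
have m2 : m.+1%:R <= 2 * m%:R :> R by rewrite -natr1; lra.
apply: (@le_lt_trans _ _ (2 * m%:R * q ^+ N)); first by rewrite ler_wpM2r.
rewrite -(ltr_pM2r (_ : 0 < m%:R * (e * h) ^+ 2)); last first.
  by rewrite mulr_gt0// exprn_gt0// mulr_gt0.
apply: (@le_lt_trans _ _ 2).
  have -> : 2 * m%:R * q ^+ N * (m%:R * (e * h) ^+ 2) =
    2 * (q ^+ N * (e * m%:R * h) ^+ 2).
    by move: (q ^+ N) (m%:R : R) => Q M; ring.
  by rewrite ler_piMr.
by rewrite mulrCA.
Qed.

(** * Convergence in probability *)

Section main.
Context d (T : measurableType d) (R : realType) (P : probability T R).
Variable X : nat -> {RV P >-> borelC R}.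
Hypothesis X_indep : mutually_independent X.
Hypothesis X_law : forall (j : nat) (A : set (borelC R)),
      measurable A -> distribution P (X j) A = uniform_circle R A.

Let reX j (w : T) : R := complex.Re (X j w : R[i]).

Let measurable_reX j : measurable_fun setT (reX j).
Proof.
exact: (measurableT_comp (@measurable_Re R) (measurable_funPT (X j))).
Qed.

Let cmeasurable_X j : cmeasurable (fun w => X j w : R[i]).
Proof.
split; first exact: measurable_reX.
exact: (measurableT_comp (@measurable_Im R) (measurable_funPT (X j))).
Qed.

Let law (j : nat) (A : set (borelC R)) : measurable A ->
  P (X j @^-1` A) = uniform_prob (@ltr01 R) (@circle_map R @^-1` A).
Proof. by move=> mA; have := X_law j mA. Qed.

Let off_circle_null (j : nat) :
  measurable [set w | `|X j w : R[i]| != 1] /\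
  P [set w | `|X j w : R[i]| != 1] = 0%E.
Proof.
pose N z : R := complex.Re (z : R[i]) ^+ 2 + complex.Im (z : R[i]) ^+ 2.
pose A : set (borelC R) := [set z | N z != 1].
have mA : measurable A.
  have mN : measurable_fun setT (fun z : borelC R => N z).
    apply: measurable_funD; apply: measurable_funX.
      exact: measurable_Re.
    exact: measurable_Im.
  have -> : A = setT `&` (fun z : borelC R => N z) @^-1` (~` [set 1]).
    by rewrite setTI; apply/seteqP; split => z /= /eqP.
  by apply: mN => //; apply: measurableC; exact: measurable_set1.
have -> : [set w | `|X j w : R[i]| != 1] = X j @^-1` A.
  apply/seteqP; split => w; rewrite /A/= normc_def; apply: contra => /eqP.
    by rewrite /N => ->; rewrite sqrtr1.
  move=> /(congr1 (@complex.Re R))/= h.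
  rewrite /N -[X in X == _]sqr_sqrtr ?addr_ge0 ?sqr_ge0//.
  by rewrite h expr1n.
split.
  by rewrite -[X in measurable X]setTI; exact: (measurable_funPT (X j)).
rewrite law// (_ : _ @^-1` A = set0) ?measure0//.
by rewrite -subset0 => t; rewrite /A/= /N /circle_map/= cos2Dsin2 eqxx.
Qed.

Let indep_reX (js : seq nat) (B : nat -> set R) : uniq js ->
  (forall j, measurable (B j)) ->
  P (cyl reX js B) = (\prod_(j <- js) P (reX j @^-1` B j))%E.
Proof.
move=> ujs mB.
pose B' j := (fun z : borelC R => complex.Re (z : R[i])) @^-1` B j.
have mB' j : measurable (B' j).
  by rewrite -[X in measurable X]setTI; exact: measurable_Re.
rewrite (_ : cyl reX js B = \bigcap_(j in [set` js]) (X j @^-1` B' j)).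
  exact: (X_indep ujs mB').
by apply/seteqP; split => w H j; apply: H.
Qed.

(** The radius [rho] does not depend on the number of terms: the mesh of the
    discretization is [rho / 2] divided by that number. *)
Lemma sum_re_small_ball (kappa : R) : 0 < kappa -> exists2 rho : R, 0 < rho &
  forall n, (P [set w | (`|\sum_(j < n.+1) reX j w| < rho)%R] <= kappa%:E)%E.
Proof.
move=> k0; have [rho r0 H] := cos_small_ball k0.
exists (rho / 2); first by rewrite divr_gt0.
move=> n; have H' := @anti_concentration _ _ _ P reX measurable_reX indep_reX kappa
  rho (rho / 2 / n.+1%:R) n 0 (rho / 2) [::] (fun=> setT) (ltW k0).
move: H'; rewrite big_nil mule1 => {}H'.
have : (P ([set w | (`|\sum_(j < n.+1) reX j w + 0| < rho / 2)%R] `&`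
   cyl reX [::] (fun=> setT)) <= kappa%:E)%E.
  apply: H' => //; first by rewrite !divr_gt0.
    move=> j x; have := H x.
    pose A : set (borelC R) := [set z | `|complex.Re (z : R[i]) + x| < rho].
    have mA : measurable A.
      apply: measurable_norm_lt; apply: measurable_funD; first exact: measurable_Re.
      exact: measurable_cst.
    by have := law j mA => /= <-.
  rewrite [leRHS](splitr rho) lerD2l -[_ *+ n]mulr_natr -mulrA ler_piMr//.
    by rewrite divr_ge0// ltW.
  by rewrite mulrC ler_pdivrMr// mul1r ler_nat.
rewrite (_ : [set w | _] `&` _ = [set w | (`|\sum_(j < n.+1) reX j w| < rho / 2)%R])//.
by apply/seteqP; split => w /=; rewrite addr0 => // -[].
Qed.

Variable eps : R.
Hypothesis eps_gt0 : 0 < eps.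
Let f (n : nat) (w : T) : {poly R[i]} := \prod_(j < n) ('X - (X j w : R[i])%:P).
Let U : pred R[i] := fun z => eps%:C < `| `|z| - 1 |.

Let fE n w : f n w = rootprod [seq (X j w : R[i]) | j <- iota 0 n].
Proof. by rewrite /f /rootprod big_map -[n in iota _ n]subn0 big_mkord. Qed.

Let size_f' n w : size (f n w)^`() = n.
Proof. by rewrite fE size_deriv_rootprod size_map size_iota. Qed.

Let valueE n w : fine (root_dist (f n w)^`() [set z : R[i] | U z]) =
  (n.-1%:R)^-1 * (count U (poly_roots (f n w)^`()))%:R.
Proof. by rewrite fine_root_dist size_f'. Qed.

Let measurable_value n : measurable_fun setT
  (fun w => fine (root_dist (f n w)^`() [set z : R[i] | U z])).
Proof.
under eq_fun do rewrite valueE.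
case: n => [|n].
  by under eq_fun do rewrite invr0 mul0r; exact: measurable_cst.
apply: measurable_funM; first exact: measurable_cst.
have f'0 w : (f n.+1 w)^`() != 0 by rewrite -size_poly_eq0 size_f'.
have szr w : size (poly_roots (f n.+1 w)^`()) = n.
  by rewrite size_poly_roots// size_f'.
apply: (@measurable_fun_count _ _ _ _ n).
  by move=> w; rewrite -[leqRHS](szr w) count_size.
move=> m; apply: (@measurable_count_roots _ _ _ (fun w => (f n.+1 w)^`())) szr _ _ => //.
- move=> k; under eq_fun do rewrite coef_deriv fE -mulr_natr.
  apply: cmeasurableM; last exact: cmeasurable_cst.
  exact: cmeasurable_coef_rootprod.
- exists n.+1%:R => [|w]; first by rewrite pnatr_eq0.
  rewrite [LHS]poly_roots_eq {1}fE lead_coef_deriv_rootprod.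
  by rewrite size_map size_iota.
- exact: off_circle_open.
Qed.

Let q := Num.max (1 - eps) 2^-1.
Let q01 : 0 < q < 1.
Proof.
rewrite /q lt_max gt_max; apply/andP; split; first by apply/orP; right; lra.
by rewrite ltrBlDr ltrDl eps_gt0 invf_lt1 // ltr1n.
Qed.

Let sum_re_le n w : (forall j : nat, `|X j w : R[i]| = 1) ->
  `|\sum_(j < n.+1) reX j w| <=
    n.+1%:R * q ^+ count U (poly_roots (f n.+1 w)^`()).
Proof.
move=> X1; set rs := poly_roots _.
have H : `|\sum_(x <- [seq (X j w : R[i]) | j <- iota 0 n.+1]) x| <=
    (size [seq (X j w : R[i]) | j <- iota 0 n.+1])%:R * q%:C ^+ count U rs.
  apply: norm_sum_le_critical => //.
  - by rewrite ler0c ltW//; case/andP: q01.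
  - by move=> _ /mapP[j _ ->].
  - by rewrite -fE -poly_roots_eq.
  - by move=> r r1 Ur; apply: off_circle_le.
rewrite -lecR (le_trans _ (le_trans H _))//.
  rewrite big_map -[X in iota _ X]subn0 -/(index_iota 0 n.+1) big_mkord.
  rewrite (_ : \sum_(j < n.+1) reX j w = complex.Re (\sum_(j < n.+1) (X j w : R[i]))).
    exact: normc_ge_Re.
  by rewrite raddf_sum.
by rewrite size_map size_iota rmorphM/= rmorphXn rmorph_nat.
Qed.

Lemma cvg_off_circle : cvg_in_probability P
    (fun n w => fine (root_dist (f n w)^`() [set z : R[i] | U z])) (cst 0).
Proof.
split; [exact: measurable_value|exact: measurable_cst|move=> e e0].
pose bad n := [set w | e < `|fine (root_dist (f n w)^`() [set z : R[i] | U z]) - cst 0 w|].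
have mbad n : measurable (bad n).
  have -> : bad n = setT `&`
    (fun w => fine (root_dist (f n w)^`() [set z : R[i] | U z])) @^-1` (~` `[- e, e]).
    rewrite setTI; apply/seteqP; split => w; rewrite /bad/= in_itv/= subr0 -ler_norml ltNge;
      by move/negP.
  by apply: measurable_value => //; apply: measurableC; exact: measurable_itv.
pose N := \bigcup_j [set w | `|X j w : R[i]| != 1].
have mN1 (j : nat) : measurable [set w | `|X j w : R[i]| != 1].
  by have [] := off_circle_null j.
have mN : measurable N by apply: bigcupT_measurable.
have PN : P N = 0%E.
  apply/eqP; rewrite eq_le measure_ge0 andbT.
  apply: le_trans (measure_sigma_subadditive P mN1 mN (@subset_refl _ _)) _.
  by rewrite eseries0// => i _ _; have [] := off_circle_null i.
apply/fine_cvgP; split.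
  by apply: nearW => n; apply: fin_num_measure; exact: mbad.
apply/cvgrPdist_le => kappa kappa0.
have [rho rho0 Hrho] := sum_re_small_ball kappa0.
have [n0 Hn0] := exp_decay q01 e0 rho0.
exists n0.+1 => // -[//|n] /= n0n.
rewrite sub0r normrN ger0_norm ?fine_ge0//.
rewrite -lee_fin fineK; last by apply: fin_num_measure; exact: mbad.
have mS : measurable [set w | `|\sum_(j < n.+1) reX j w| < rho].
  by apply: measurable_norm_lt; exact: measurable_sum.
(* Off the null set N, the event is contained in the small ball event. *)
apply: le_trans (Hrho n); rewrite -[leRHS]adde0 -PN.
apply: le_trans (measureU2 _ mS mN).
apply: le_measure; rewrite ?inE; [exact: mbad|exact: measurableU|].
move=> w /=; rewrite valueE subr0 ger0_norm ?mulr_ge0// => ew.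
have [Nw|Nw] := pselect (N w); [by right|left].
apply: le_lt_trans (Hn0 _ _ n0n ew); apply: sum_re_le => j.
by apply/eqP; apply/negPn/negP => h; apply: Nw; exists j.
Qed.
End main.

Theorem theorem2p4 (R : realType) (d : measure_display)
    (T : measurableType d) (P : probability T R)
    (X : nat -> {RV P >-> borelC R})
    (X_indep : mutually_independent X)
    (X_law : forall (j : nat) (A : set (borelC R)),
      measurable A -> distribution P (X j) A = uniform_circle R A)
    (eps : R) (eps_gt0 : 0 < eps) :
  let f (n : nat) (w : T) : {poly R[i]} :=
    \prod_(j < n) ('X - (X j w : R[i])%:P) in
  cvg_in_probability P
    (fun n w => fine (root_dist (f n w)^`()
       [set z : R[i] | eps%:C < `| `|z| - 1 | ]))
    (cst 0).
Proof. exact: (cvg_off_circle X_indep X_law eps_gt0). Qed.
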